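(* Let $a=(a_i)_{i\in\mathbb Z}$ be a sequence in $\Bbbk$. The set of $a$-shifted ribbon Schur functions $R_{I;a}$, where $I$ runs over all compositions, forms a $\mathbb Z[a]$-basis of $\mathrm{Sym}^a_{\mathbb Z}$. Moreover, for two (nonempty) compositions $I=(i_1,\ldots,i_n)$ and $J=(j_1,\ldots,j_m)$, with $d_J=j_1+\cdots+j_m$, one has $$R_{I;a}^{[d_J-j_m+i_n]}\,R_{J;a}=R_{I\cdot J;a}+R_{I\triangleright J;a}\qquad\text{if } m\ge 2,$$ $$R_{I;a}^{[i_n]}\,S_{j_1;a}=R_{I\cdot (j_1);a}+R_{I\triangleright (j_1);a}^{[i_n]}\qquad\text{if } m=1,$$ where $I\cdot J=(i_1,\ldots,i_n,j_1,\ldots,j_m)$ and $I\triangleright J=(i_1,\ldots,i_{n-1},i_n+j_1,j_2,\ldots,j_m)$.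
   Context: $\Bbbk$ is a field of characteristic zero and $a=(a_i)_{i\in\mathbb Z}$ is a sequence in $\Bbbk$. $\mathbb Z[a]\subseteq\Bbbk$ is the subring generated by all $a_i$. Put $(t\downarrow a)^k=(t-a_1)\cdots(t-a_k)$, $(t\downarrow a)^0=1$, and $(\tau^s a)_i=a_{i+s}$ for $s\in\mathbb Z$. $\mathrm{Sym}^a=\Bbbk\langle S_{1;a},S_{2;a},\ldots\rangle$ is the free associative unital $\Bbbk$-algebra on $S_{k;a}$, $k\ge1$, and $\mathrm{Sym}^a_{\mathbb Z}=\mathbb Z[a]\langle S_{1;a},S_{2;a},\ldots\rangle\subset \mathrm{Sym}^a$; $S_{0;a}=1$. Shifts: for $s\in\mathbb Z$, the elements $S_{k;a}^{[s]}\in\mathrm{Sym}^a$ are defined by $\sum_{k\ge0} S_{k;a}^{[s]}/(t\downarrow\tau^{-s}a)^k=\sum_{k\ge0}S_{k;a}/(t\downarrow a)^k$, where $t$ is a central variable and both sides are expanded as formal power series in $1/t$. Quasideterminants: for an $n\times n$ matrix $A$ over a unital ring such that the matrix $A^{pq}$ (delete row $p$ and column $q$) is invertible, $|A|_{pq}=a_{pq}-r(A^{pq})^{-1}c$, where $r$ is the $p$-th row of $A$ with $a_{pq}$ removed and $c$ is the $q$-th column of $A$ with $a_{pq}$ removed. A composition is a finite sequence $I=(i_1,\ldots,i_n)$ of positive integers (including the empty composition, for which $R_{\emptyset;a}=1$). For $K=(k_1,\ldots,k_n)\in\mathbb Z^n$ set $R_{I;a}^{[K]}=(-1)^{n-1}|M|_{1n}$,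 where $M$ is the $n\times n$ matrix with entries $M_{pq}=S_{i_p+i_{p+1}+\cdots+i_q;a}^{[k_p]}$ if $p\le q$, $M_{q+1,q}=1$, and $M_{pq}=0$ if $p>q+1$. With $s_k=\sum_{\nu=k}^{n-1}i_\nu$ ($1\le k\le n-1$) the $a$-shifted ribbon Schur function is $R_{I;a}=R_{I;a}^{[(s_1,\ldots,s_{n-1},0)]}$, and for $s\in\mathbb Z$, $R_{I;a}^{[s]}=R_{I;a}^{[(s_1+s,\ldots,s_{n-1}+s,s)]}$. *)

(* Defs.v *)
From HB Require Import structures.
From mathcomp Require Import all_boot all_algebra.
From mathcomp Require Import finmap boolp classical_sets.
From mathcomp Require Import monalg.

Set Implicit Arguments.
Unset Strict Implicit.
Unset Printing Implicit Defensive.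

Import GRing.Theory.

Local Open Scope ring_scope.

(* Over a noncommutative ring [invmx] is unavailable.  The value is [0] by
   convention when [A] has no two-sided inverse. *)
Definition mxinv (R : nzRingType) (n : nat) (A : 'M[R]_n) : 'M[R]_n :=
  xget 0 [set B : 'M[R]_n | A *m B = 1%:M /\ B *m A = 1%:M]%classic.

Lemma mxinv_eq (R : nzRingType) (n : nat) (A B : 'M[R]_n) :
  A *m B = 1%:M -> B *m A = 1%:M -> mxinv A = B.
Proof.
move=> AB BA; rewrite /mxinv; case: xgetP => [C _ [AC CA]|/(_ B)]; last first.
  by case.
by rewrite -[LHS]mul1mx -BA -mulmxA AC mulmx1.
Qed.

Definition quasidet (R : nzRingType) (n : nat) (A : 'M[R]_n) (p q : 'I_n) : R :=
  A p q - (row p (col' q A) *m mxinv (row' p (col' q A))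
             *m col q (row' p A)) 0 0.

(* [f : nat -> V] stands for the formal series \sum_N f N * t^(-N). *)

Definition series_mul (K : nzRingType) (f g : nat -> K) (N : nat) : K :=
  \sum_(j < N.+1) f j * g (N - j)%N.

(* 1/(t - c) = \sum_j c^j t^(-j-1) *)
Definition inv_linear (K : nzRingType) (c : K) (N : nat) : K :=
  if N is j.+1 then c ^+ j else 0.

(* The series of 1/(t | b)^k = 1/((t - b_1) ... (t - b_k)). *)
Fixpoint inv_factorial (K : nzRingType) (b : int -> K) (k : nat) : nat -> K :=
  if k is k'.+1 then series_mul (inv_factorial b k') (inv_linear (b k))
  else fun N => (N == 0)%:R.

(* The series \sum_(k >= 0) F_k / (t | b)^k.  As 1/(t | b)^k has no term
   t^(-N) with N < k, the coefficient of t^(-N) is a finite sum. *)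
Definition factorial_series (K : nzRingType) (V : lmodType K)
    (b : int -> K) (F : nat -> V) (N : nat) : V :=
  \sum_(k < N.+1) inv_factorial b k N *: F k.

Lemma inv_factorial_lt (K : nzRingType) (b : int -> K) (k N : nat) :
  (N < k)%N -> inv_factorial b k N = 0.
Proof.
elim: k N => [//|k IH] N leNk; rewrite /= /series_mul big1 // => j _.
case: (ltnP j k) => [/IH -> |lekj]; first by rewrite mul0r.
have /eqP -> : (N - j == 0)%N by rewrite subn_eq0 (leq_trans _ lekj).
by rewrite mulr0.
Qed.

Lemma inv_factorial_diag (K : nzRingType) (b : int -> K) (k : nat) :
  inv_factorial b k k = 1.
Proof.
elim: k => [//|k IH]; rewrite /= /series_mul 2!big_ord_recr big1 /=; last first.
  by move=> j _; rewrite inv_factorial_lt ?mul0r.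
by rewrite subnn mulr0 addr0 add0r subSnn /= ?expr0 mulr1 IH.
Qed.

Lemma factorial_series_ex (K : nzRingType) (V : lmodType K) (b : int -> K)
    (f : nat -> V) : exists F : nat -> V, factorial_series b F = f.
Proof.
pose next (s : seq V) : V :=
  f (size s) - \sum_(k < size s) inv_factorial b k (size s) *: nth 0 s k.
pose pre := fix pre N := if N is M.+1 then rcons (pre M) (next (pre M)) else [::].
have szpre N : size (pre N) = N by elim: N => //= N IH; rewrite size_rcons IH.
have nthpre N k : (k < N)%N -> nth 0 (pre N) k = next (pre k).
  elim: N => //= N IH; rewrite ltnS nth_rcons szpre => lekN.
  by case: ltngtP lekN => [/IH|//|->].
exists (fun k => next (pre k)); apply/funext => N.
rewrite /factorial_series big_ord_recr /= inv_factorial_diag scale1r.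
rewrite /next szpre addrCA -[RHS]addr0; congr (_ + _); apply/eqP.
rewrite subr_eq0; apply/eqP; apply: eq_bigr => k _.
by rewrite nthpre.
Qed.

Lemma factorial_series_inj (K : nzRingType) (V : lmodType K) (b : int -> K)
    (F G : nat -> V) : factorial_series b F = factorial_series b G -> F = G.
Proof.
move=> eqFG; apply/funext => N; elim/ltn_ind: N => N IH.
have := congr1 (fun f => f N) eqFG; rewrite /factorial_series /= !big_ord_recr /=.
rewrite inv_factorial_diag !scale1r.
by under eq_bigr => k _ do rewrite IH //; move=> /addrI.
Qed.

(* The free associative algebra: the monoid algebra of the free monoid on
   letters j : nat, where the letter j is the generator S_{j+1;a}.  Nothing in
   its construction depends on the sequence a. *)
Notation Sym k := {malg k[{fmonom nat}]}.

Definition Sgen (k : fieldType) (j : nat) : Sym k :=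
  if j is j'.+1 then << fmu j' >> else 1.

Definition tau (k : fieldType) (s : int) (a : int -> k) : int -> k :=
  fun i => a (i + s).

Definition Sshift (k : fieldType) (a : int -> k) (s : int) : nat -> Sym k :=
  xget (@Sgen k)
    [set F : nat -> Sym k |
      factorial_series (tau (- s) a) F = factorial_series a (@Sgen k)]%classic.

Lemma SshiftP (k : fieldType) (a : int -> k) (s : int) :
  factorial_series (tau (- s) a) (Sshift a s) = factorial_series a (@Sgen k).
Proof.
rewrite /Sshift; case: xgetP => [F _ //|noF].
have [F eqF] :=
  factorial_series_ex (tau (- s) a) (factorial_series a (@Sgen k)).
by case: (noF F).
Qed.

(* Z[a], the subring of k generated by all a_i. *)
Definition Za (k : fieldType) (a : int -> k) : set k :=
  smallest [set A : set k | GRing.subring_closed [in A]]%classic (range a).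

Definition SymZ (k : fieldType) (a : int -> k) : set (Sym k) :=
  [set f : Sym k | forall w : {fmonom nat}, f@_w \in Za a]%classic.

Definition is_composition (I : seq nat) : bool := all (fun i => 0 < i)%N I.

Definition composition := {I : seq nat | is_composition I}.

(* Rows, columns and parts are numbered from 0; only the values K_p with
   p < size I are used. *)
Definition ribbon_mx (k : fieldType) (a : int -> k) (I : seq nat)
    (K : nat -> int) (n : nat) : 'M[Sym k]_n :=
  \matrix_(p < n, q < n)
    if (p <= q)%N then Sshift a (K p) (\sum_(p <= l < q.+1) nth 0%N I l)%N
    else if p == q.+1 :> nat then 1 else 0.

Definition ribbonK (k : fieldType) (a : int -> k) (I : seq nat)
    (K : nat -> int) : Sym k :=
  if size I is n'.+1 then
    (-1) ^+ n' * quasidet (ribbon_mx a I K n'.+1) ord0 ord_max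
  else 1.

(* The sum of the parts from position p up to the last but one; it is 0 for the
   last position. *)
Definition ribbon_shift (I : seq nat) (p : nat) : int :=
  (\sum_(p <= l < (size I).-1) nth 0 I l)%N%:Z.

Definition ribbon (k : fieldType) (a : int -> k) (I : seq nat) : Sym k :=
  ribbonK a I (ribbon_shift I).

Definition ribbon_sh (k : fieldType) (a : int -> k) (s : int) (I : seq nat) :
    Sym k :=
  ribbonK a I (fun p => ribbon_shift I p + s).

(* (i_1, ..., i_{n-1}, i_n + j_1, j_2, ..., j_m), for nonempty I and J. *)
Definition near_concat (I J : seq nat) : seq nat :=
  take (size I).-1 I ++ (last 0 I + head 0 J)%N :: behead J.

(* The family (v_i) is a D-basis of the D-module M, for a subring D of K. *)
Definition is_basis_over (K : nzRingType) (V : lmodType K) (D : set K)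
    (M : set V) (T : choiceType) (v : T -> V) : Prop :=
  [/\ forall i : T, v i \in M,
      forall x : V, x \in M ->
        exists (A : {fset T}) (c : T -> K),
          (forall i : T, c i \in D) /\ x = \sum_(i <- A) c i *: v i
    & forall (A : {fset T}) (c : T -> K),
        (forall i : T, c i \in D) -> \sum_(i <- A) c i *: v i = 0 ->
        forall i : T, i \in A -> c i = 0].

(* Main.v *)
Require Import Defs.
From HB Require Import structures.
From mathcomp Require Import all_boot all_algebra.
From mathcomp Require Import finmap boolp classical_sets.
From mathcomp Require Import monalg.
From mathcomp Require Import zify.

Set Implicit Arguments.
Unset Strict Implicit.
Unset Printing Implicit Defensive.

Import GRing.Theory.

Local Open Scope ring_scope.

(** Products.  The matrix that defines a ribbon function is upper triangular
    with an extra diagonal of ones just below the diagonal, and its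
    quasideterminant at the top right corner is the alternating sum, over all
    ways of cutting the rows into consecutive blocks, of the products of the
    entries (first row, last column) of the blocks.  Sorting the terms by
    whether there is a cut after the first part gives a rule with two terms,
      R_(i,j,I) = S_i R_(j,I) - R_(i+j,I),
    in which every block keeps the shift attached to its first row
    ([ribbonK_cons2]).  Induction on the left factor turns it into
      R_I R_J = R_(I.J) + R_(I|>J)
    for arbitrary shifts, read off from one sequence K along I.J: the merged
    part of I|>J starts in I, so only the shift of the first part of J
    disappears ([ribbonK_mul]).  What is then left of the two product formulas
    is that the prescribed shifts do come from one sequence: as
      s_p = (sum of the parts from p on) - (last part),
    the shifts of I.J restrict on J to those of J, and on I to those of I
    increased by d_J - j_m + i_n.  For m >= 2 the last part of I|>J is again
    j_m, and its shifts are those of I.J; for m = 1 the last part is i_n + j_1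
    and they differ by i_n.

    Basis.  Give the word S_(i_1)...S_(i_n) the weight i_1 + ... + i_n + n.
    Comparing coefficients in the definition of the shift, the element
    S_k^[s] is S_k plus a Z[a]-combination of the S_l with l < k
    ([Sshift_low]); merging two parts keeps the sum but shortens the word.  So
    both kinds of correction lower the weight, and the rule with two terms
    shows that R_I is the word of I plus a Z[a]-combination of words of smaller
    weight ([ribbonK_low]).  A family that is unitriangular in this sense over a
    subring is a basis over that subring ([unitriangular_basis]). *)

(** * Quasideterminants of unit Hessenberg matrices *)

(** Block by block: if [B] inverts the lower right block, the inverse of
    (1, U; 0, D) is (1, - U B; 0, B).  This works over any ring and produces
    both one-sided inverses at once. *)
Lemma unitriangular_inv (R : nzRingType) (n : nat) (A : 'M[R]_n) :
    (forall i j : 'I_n, (j < i)%N -> A i j = 0) -> (forall i, A i i = 1) ->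
  exists B : 'M[R]_n, A *m B = 1%:M /\ B *m A = 1%:M.
Proof.
elim: n A => [|n IHn] A A0 A1.
  by exists 0; split; rewrite [LHS]flatmx0 [RHS]flatmx0.
rewrite -[n.+1]/(1 + n)%N in A A0 A1 *.
have [i j ltji|i|B [AB BA]] := IHn (drsubmx A).
- by rewrite !mxE A0 //= ltn_add2l.
- by rewrite !mxE A1.
have ul1 : ulsubmx A = 1%:M.
  by apply/matrixP=> i j; rewrite !mxE !ord1; exact: A1.
have dl0 : dlsubmx A = 0.
  by apply/matrixP=> i j; rewrite !mxE A0 //= ord1.
have defA := submxK A; rewrite ul1 dl0 in defA.
move: (ursubmx A) (drsubmx A) defA AB BA => U D <- AB BA.
exists (block_mx 1%:M (- (U *m B)) 0 B); rewrite !mulmx_block.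
rewrite !(mul1mx, mulmx1, mul0mx, mulmx0, addr0, add0r) AB BA.
by rewrite mulNmx -mulmxA BA mulmx1 addrN addNr -!scalar_mx_block.
Qed.

(** The inverse enters a quasideterminant only through its product with a
    column, so that any solution of the linear system computes it. *)
Lemma quasidet_solve (R : nzRingType) (n : nat) (A : 'M[R]_n) (p q : 'I_n)
    (x : 'cV[R]_n.-1) :
    (exists B, row' p (col' q A) *m B = 1%:M /\ B *m row' p (col' q A) = 1%:M) ->
    row' p (col' q A) *m x = col q (row' p A) ->
  quasidet A p q = A p q - (row p (col' q A) *m x) 0 0.
Proof.
move=> [B [AB BA]] Ax; rewrite /quasidet (mxinv_eq AB BA) -Ax.
by rewrite -mulmxA [B *m _]mulmxA BA mul1mx.
Qed.

Section Hessenberg.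
Variables (R : nzRingType).
Implicit Type G : nat -> nat -> R.

Definition hessenberg G (n : nat) : 'M[R]_n :=
  \matrix_(p < n, q < n)
    if (p <= q)%N then G p q else if p == q.+1 :> nat then 1 else 0.

(** The signed quasideterminant of the rows [p], [q.+1], ..., [q + m] and the
    columns [q], ..., [q + m]: the first block already extends from [p] to [q],
    and each step decides whether it is cut after column [q]. *)
Fixpoint hessenberg_qdet G (p q m : nat) : R :=
  if m is m'.+1 then
    G p q * hessenberg_qdet G q.+1 q.+1 m' - hessenberg_qdet G p q.+1 m'
  else G p q.

(** Expansion along the first row, by the place [q + r] where the first block
    ends; the last term, where it takes all the columns, is set apart.  The
    signs are grouped so that this is one step of back substitution in the
    triangular system of [quasidet_solve]. *)
Lemma hessenberg_qdetE G (p q m : nat) :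
  (-1) ^+ m * hessenberg_qdet G p q m =
    G p (q + m)%N
    - \sum_(r < m) G p (q + r)%N
        * ((-1) ^+ (m - r.+1)
           * hessenberg_qdet G (q + r).+1 (q + r).+1 (m - r.+1)).
Proof.
elim: m q => [|m IHm] q /=; first by rewrite big_ord0 subr0 mul1r addn0.
rewrite mulrBr exprS mulN1r !mulNr opprK addrC IHm addSnnS -addrA.
rewrite big_ord_recl /= addn0 subSS subn0 -opprD; congr (_ - _).
rewrite addrC !mulrA (commr_sign (G p q)); congr (_ + _).
by apply: eq_bigr => r _; rewrite /bump /= add1n subSS addSnnS.
Qed.

(** Reindexing rows by [g] and columns by [f].  A block that is cut off starts
    at the row following a column, hence the condition linking [g] and [f]
    beyond the first row. *)
Lemma eq_hessenberg_qdet G G' (f g : nat -> nat) :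
    (forall q, f q.+1 = (f q).+1) ->
    (forall q, g q.+1 = f q.+1) ->
    (forall p q, (p <= q)%N -> G (g p) (f q) = G' p q) ->
  forall p q m, (p <= q)%N ->
  hessenberg_qdet G (g p) (f q) m = hessenberg_qdet G' p q m.
Proof.
move=> fS gS eqG p q m; elim: m p q => [|m IHm] p q lepq /=; first exact: eqG.
rewrite eqG // -fS -{1}gS !IHm //; exact: leqW.
Qed.

Lemma quasidet_hessenberg G (n : nat) :
  (-1) ^+ n * quasidet (hessenberg G n.+1) ord0 ord_max
  = hessenberg_qdet G 0 0 n.
Proof.
(* Once the first row and the last column are deleted, the matrix is upper
   unitriangular; the solution at row r is the signed quasideterminant of the
   rows after r. *)
pose x : 'cV[R]_n :=
  \col_r ((-1) ^+ (n - r.+1) * hessenberg_qdet G r.+1 r.+1 (n - r.+1)).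
set M := hessenberg G n.+1.
have ME (p q : 'I_n.+1) : M p q =
    if (p <= q)%N then G p q else if p == q.+1 :> nat then 1 else 0.
  by rewrite mxE.
have lift0E (i : 'I_n) : nat_of_ord (lift ord0 i) = i.+1 by [].
have liftmE (i : 'I_n) : nat_of_ord (lift ord_max i) = i.
  by rewrite /= /bump leqNgt ltn_ord.
rewrite (@quasidet_solve _ _ M ord0 ord_max x).
- rewrite -[RHS](signrMK n) hessenberg_qdetE ME /= !mxE add0n.
  by congr (_ * (_ - _)); apply: eq_bigr => r _; rewrite !mxE leq0n liftmE.
- apply: unitriangular_inv => [i j ltji|i]; rewrite !mxE lift0E liftmE.
    by rewrite leqNgt ltnS ltnW //= eqSS gtn_eqF.
  by rewrite ltnn eqxx.
apply/matrixP=> i j; rewrite !mxE lift0E /= ltn_ord.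
(* Row i of the system: no terms before the diagonal, a coefficient 1 on it,
   and after it the sum that the expansion of x_i subtracts. *)
pose y r := (-1) ^+ (n - r.+1) * hessenberg_qdet G r.+1 r.+1 (n - r.+1).
pose c r := if (i.+1 <= r)%N then G i.+1 r else if i.+1 == r.+1 then 1 else 0.
rewrite (eq_bigr (fun r : 'I_n => c r * y r)); last first.
  by move=> r _; rewrite !mxE lift0E liftmE.
rewrite -(big_mkord xpredT (fun r => c r * y r)).
rewrite (@big_cat_nat _ _ _ i) ?(ltnW (ltn_ord i)) //= big_nat big1; last first.
  move=> r /andP[_ ltri].
  by rewrite /c leqNgt ltnS ltnW //= eqSS gtn_eqF // mul0r.
rewrite add0r big_ltn // {1}/c ltnn eqxx mul1r {1}/y hessenberg_qdetE.
rewrite subnKC // -[X in \sum_(X <= _ < _) _]add0n big_addn big_mkord.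
rewrite [X in _ + X](_ : _ = \sum_(r < n - i.+1) G i.+1 (i.+1 + r)%N
    * ((-1) ^+ (n - i.+1 - r.+1) * hessenberg_qdet G (i.+1 + r).+1 (i.+1 + r).+1
      (n - i.+1 - r.+1))); first by rewrite subrK.
by apply: eq_bigr => r _; rewrite /c /y addnC leq_addr -subnDA addnS.
Qed.

End Hessenberg.

(** * Products of ribbon functions with arbitrary shifts *)

Lemma mulBl_split (R : nzRingType) (s r1 r2 p u1 u2 v1 v2 : R) :
    r1 * p = u1 + v1 -> r2 * p = u2 + v2 ->
  (s * r1 - r2) * p = (s * u1 - u2) + (s * v1 - v2).
Proof. by move=> e1 e2; rewrite mulrBl -mulrA e1 e2 mulrDr opprD addrACA. Qed.

Section Ribbon.
Variables (k : fieldType) (a : int -> k).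
Implicit Types (I J : seq nat) (K : nat -> int).

Definition ribbon_entry I K (p q : nat) : Sym k :=
  Sshift a (K p) (\sum_(p <= l < q.+1) nth 0 I l)%N.

Lemma ribbonK_qdet (i : nat) I K :
  ribbonK a (i :: I) K
  = hessenberg_qdet (ribbon_entry (i :: I) K) 0 0 (size I).
Proof. exact: quasidet_hessenberg. Qed.

Lemma eq_ribbonK I K K' :
  (forall p, (p < size I)%N -> K p = K' p) -> ribbonK a I K = ribbonK a I K'.
Proof.
move=> eqK; rewrite /ribbonK; case: (size I) eqK => [//|n] eqK.
suff -> : ribbon_mx a I K n.+1 = ribbon_mx a I K' n.+1 by [].
by rewrite /ribbon_mx; apply: eq_mx => p q; rewrite (eqK _ (ltn_ord p)).
Qed.

(** The shifts left when the first two parts are merged: the second one is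
    never the start of a block any more. *)
Definition skip_shift K (p : nat) : int := if p is p'.+1 then K p'.+2 else K 0%N.

Lemma ribbonK1 (i : nat) K : ribbonK a [:: i] K = Sshift a (K 0%N) i.
Proof. by rewrite ribbonK_qdet /= /ribbon_entry big_nat1. Qed.

(** The cut after the first part is either made or not. *)
Lemma ribbonK_cons2 (i j : nat) I K :
  ribbonK a [:: i, j & I] K
  = Sshift a (K 0%N) i * ribbonK a (j :: I) (fun p => K p.+1)
    - ribbonK a ((i + j)%N :: I) (skip_shift K).
Proof.
rewrite !ribbonK_qdet.
set G := ribbon_entry [:: i, j & I] K.
have -> : hessenberg_qdet (ribbon_entry (j :: I) (fun p => K p.+1)) 0 0 (size I)
    = hessenberg_qdet G 1 1 (size I).
  apply/esym/(@eq_hessenberg_qdet _ _ _ succn succn) => // p q _.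
  by rewrite /G /ribbon_entry big_add1.
have -> : hessenberg_qdet (ribbon_entry ((i + j)%N :: I) (skip_shift K)) 0 0
    (size I) = hessenberg_qdet G 0 1 (size I).
  pose g p := if p is p'.+1 then p'.+2 else 0%N.
  apply/esym/(@eq_hessenberg_qdet _ G _ succn g _ _ _ 0 0) => // -[|p] q _;
    rewrite /G /ribbon_entry /=; last by rewrite !big_add1.
  by rewrite !(big_ltn (ltn0Sn _)) !big_add1 /= big_ltn // big_add1 addnA.
by rewrite [LHS]/= {1}/G /ribbon_entry big_nat1.
Qed.

(** In the expansion of [R_(I.J)] over cuttings into blocks, the terms with a
    cut between [I] and [J] make up the product on the left, and the others
    make up [- R_(I|>J)].  The induction peels off the first part of [I]. *)
Lemma ribbonK_mul I J K :
    I != [::] -> J != [::] ->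
  ribbonK a I K * ribbonK a J (fun p => K (size I + p)%N)
  = ribbonK a (I ++ J) K
    + ribbonK a (near_concat I J)
        (fun p => K (if p < size I then p else p.+1)%N).
Proof.
case: I => // i I _; case: J => // j J _.
elim: I i K => [|i' I IHI] i K.
  rewrite (_ : ribbonK a (near_concat [:: i] (j :: J)) _ =
    ribbonK a ((i + j)%N :: J) (skip_shift K)); last first.
    by apply: eq_ribbonK => -[|p].
  by rewrite ribbonK1 ribbonK_cons2 subrK.
(* Merging the two first parts of I commutes with merging I and J, also when
   these two parts are all of I. *)
have [x [X [eqX eqY]]] : exists x X,
    near_concat (i' :: I) (j :: J) = x :: X
    /\ near_concat ((i + i')%N :: I) (j :: J) = (i + x)%N :: X.
  case: I {IHI} => [|i2 I]; last by exists i'; eexists.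
  by exists (i' + j)%N, J; rewrite /near_concat /= addnA.
have nearE : near_concat [:: i, i' & I] (j :: J) = [:: i, x & X].
  by rewrite -eqX.
set P := ribbonK a (j :: J) _.
have IH1 : ribbonK a (i' :: I) (fun p => K p.+1) * P
    = ribbonK a (i' :: I ++ j :: J) (fun p => K p.+1)
      + ribbonK a (x :: X)
          (fun p => K (if p < size (i' :: I) then p else p.+1)%N.+1).
  by rewrite -eqX; exact: (IHI i' (fun p => K p.+1)).
have IH2 : ribbonK a ((i + i')%N :: I) (skip_shift K) * P
    = ribbonK a ((i + i')%N :: I ++ j :: J) (skip_shift K)
      + ribbonK a ((i + x)%N :: X)
          (fun p => skip_shift K (if p < size (i' :: I) then p else p.+1)%N).
  by rewrite -eqY; exact: (IHI (i + i')%N (skip_shift K)).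
rewrite nearE (ribbonK_cons2 i i' I).
rewrite [[:: i, i' & I] ++ _]/= (ribbonK_cons2 i i' (I ++ _)).
rewrite (ribbonK_cons2 i x X).
apply: mulBl_split; [rewrite IH1 | rewrite IH2]; congr (_ + ribbonK a _ _).
  by apply/funext => p /=; rewrite (ltnS p.+1); case: ifP.
by apply/funext => -[|p] //=; rewrite (ltnS p.+2); case: ifP.
Qed.

(** * The two product formulas *)

(** In this form the shifts of a concatenation are easily compared with those
    of its factors. *)
Lemma ribbon_shiftE I (p : nat) : (p < size I)%N ->
  ribbon_shift I p = (sumn (drop p I))%:Z - (last 0%N I)%:Z.
Proof.
rewrite /ribbon_shift; case/lastP: I => // I x.
rewrite size_rcons last_rcons ltnS /= => lepI.
rewrite drop_rcons // sumn_rcons PoszD addrK; congr Posz.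
rewrite sumnE [RHS](big_nth 0%N) size_drop -{1}[p]add0n big_addn.
apply: eq_big_nat => l /andP[_ ltl].
by rewrite nth_drop nth_rcons addnC; case: ltnP; lia.
Qed.

(** Both product formulas at once, before the shifts of the near concatenation
    are identified; the shift of the left factor is the one that continues the
    shifts of [J]. *)
Lemma ribbon_mul I J : I != [::] -> J != [::] ->
  ribbon_sh a ((sumn J)%:Z - (last 0%N J)%:Z + (last 0%N I)%:Z) I * ribbon a J
  = ribbon a (I ++ J)
    + ribbonK a (near_concat I J)
        (fun p => ribbon_shift (I ++ J) (if p < size I then p else p.+1)%N).
Proof.
move=> I0 J0; rewrite -(ribbonK_mul _ I0 J0).
have -> : ribbon a J
    = ribbonK a J (fun p => ribbon_shift (I ++ J) (size I + p)).
  apply: eq_ribbonK => p ltp.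
  rewrite !ribbon_shiftE ?size_cat ?ltn_add2l // drop_cat ltnNge leq_addr /=.
  by rewrite addnC addnK last_cat; case: (J) ltp.
suff -> : ribbon_sh a ((sumn J)%:Z - (last 0%N J)%:Z + (last 0%N I)%:Z) I
    = ribbonK a I (ribbon_shift (I ++ J)) by [].
apply: eq_ribbonK => p ltp.
rewrite !ribbon_shiftE ?size_cat ?ltn_addr // drop_cat ltp sumn_cat last_cat.
by case: (J) J0 => [//|j J'] _ /=; lia.
Qed.

(** Near concatenation replaces the parts at positions [(size I).-1] and
    [size I] by their sum, so that only the tail that starts at the second of
    them is lost. *)
Lemma sumn_drop_near_concat I J p : I != [::] -> J != [::] ->
  sumn (drop p (near_concat I J))
  = sumn (drop (if p < size I then p else p.+1)%N (I ++ J)).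
Proof.
case/lastP: I => // I i _; case: J => // j J _.
rewrite /near_concat size_rcons last_rcons /= -cats1 take_size_cat //.
rewrite -catA ltnS; case: leqP => [|gtp]; last first.
  have gtp1 := ltnW gtp; rewrite !drop_cat !ltnNge gtp1 (leqW gtp1) /= subSn //.
  by case: (p - _)%N (subn_gt0 (size I) p) => [|q]; rewrite ?gtp.
rewrite leq_eqVlt => /orP[/eqP->|ltp]; rewrite !drop_cat ?ltp ?ltnn ?subnn /=.
  by rewrite addnA.
by rewrite !sumn_cat /= -!addnA.
Qed.

Lemma size_near_concat I J : I != [::] -> J != [::] ->
  (size (near_concat I J)).+1 = size (I ++ J).
Proof.
case/lastP: I => // I i _; case: J => // j J _.
rewrite /near_concat size_rcons /= -cats1 take_size_cat // -catA.
by rewrite !size_cat /= !addnS.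
Qed.

Lemma last_near_concat I J : (1 < size J)%N ->
  last 0%N (near_concat I J) = last 0%N (I ++ J).
Proof. by case: J => [|? []] // *; rewrite /near_concat !last_cat. Qed.

Lemma ribbon_mul_ge2 I J : I != [::] -> (2 <= size J)%N ->
  ribbon_sh a ((sumn J)%:Z - (last 0%N J)%:Z + (last 0%N I)%:Z) I * ribbon a J
  = ribbon a (I ++ J) + ribbon a (near_concat I J).
Proof.
move=> I0 J2; have J0 : J != [::] by case: (J) J2.
rewrite (ribbon_mul I0 J0); set R := ribbonK a _ _.
suff -> : R = ribbon a (near_concat I J) by [].
apply: eq_ribbonK => p ltp.
rewrite !ribbon_shiftE ?last_near_concat ?sumn_drop_near_concat //.
by move: ltp; rewrite -ltnS size_near_concat //; case: ifP => // _ /ltnW.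
Qed.

Lemma Sshift0 : Sshift a 0 = Sgen k.
Proof.
apply: (@factorial_series_inj _ _ a); rewrite -[RHS](SshiftP a 0).
by congr factorial_series; apply/funext => i; rewrite /tau oppr0 addr0.
Qed.

Lemma ribbon1 (j : nat) : ribbon a [:: j] = Sgen k j.
Proof. by rewrite /ribbon ribbonK1 /ribbon_shift big_geq // Sshift0. Qed.

Lemma ribbon_mul_Sgen I (j : nat) : I != [::] ->
  ribbon_sh a (last 0%N I)%:Z I * Sgen k j
  = ribbon a (I ++ [:: j])
    + ribbon_sh a (last 0%N I)%:Z (near_concat I [:: j]).
Proof.
move=> I0; have := ribbon_mul I0 (isT : [:: j] != [::]).
rewrite /= addn0 subrr add0r ribbon1 => ->.
set R := ribbonK a _ _.
suff -> : R = ribbon_sh a (last 0%N I)%:Z (near_concat I [:: j]) by [].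
apply: eq_ribbonK => p ltp.
have lt2 : (p < size I)%N.
  by rewrite -ltnS; move: ltp; rewrite -ltnS size_near_concat // size_cat addn1.
rewrite lt2 !ribbon_shiftE // ?size_cat ?ltn_addr //.
rewrite sumn_drop_near_concat // lt2 last_cat /near_concat last_cat /=.
by lia.
Qed.

End Ribbon.

(** * Unitriangular families in a monoid algebra *)

(** The filtration by weight, with coefficients in [S].  The bound is strict so
    that the corrections to a word [w] lie in step [wt w]. *)
Definition below (R : nzRingType) (M : monomType) (S : {pred R}) (wt : M -> nat)
    (d : nat) : {pred {malg R[M]}} :=
  fun f => all (fun w => (f@_w \in S) && (wt w < d)%N) (msupp f).

Section Below.
Variables (R : nzRingType) (M : monomType) (S : subringClosed R) (wt : M -> nat).
Implicit Types (d e : nat) (f g : {malg R[M]}).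

Lemma belowP d f :
  reflect (forall w, f@_w \in S /\ ((d <= wt w)%N -> f@_w = 0))
    (f \in below S wt d).
Proof.
apply: (iffP allP) => [Sf w|Sf w]; last first.
  have [-> Sf0] := Sf w; rewrite -mcoeff_neq0 ltnNge.
  by apply: contra => /Sf0/eqP.
have [w_f|w_f] := boolP (w \in msupp f); last first.
  by rewrite mcoeff_outdom // rpred0.
by have /andP[-> ltwd] := Sf w w_f; split=> //; rewrite leqNgt ltwd.
Qed.

Lemma below_zmod_closed d : zmod_closed (below S wt d).
Proof.
split=> [|f g /belowP Sf /belowP Sg]; apply/belowP => w.
  by rewrite mcoeff0 rpred0.
have [[Sfw f0] [Sgw g0]] := (Sf w, Sg w); rewrite mcoeffB rpredB //.
by split=> // led; rewrite f0 // g0 // subr0.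
Qed.

HB.instance Definition _ d :=
  GRing.isZmodClosed.Build {malg R[M]} (below S wt d) (below_zmod_closed d).

Lemma below_leq d e : (d <= e)%N -> {subset below S wt d <= below S wt e}.
Proof.
move=> lede f /belowP Sf; apply/belowP => w; have [? f0] := Sf w.
by split=> // /(leq_trans lede)/f0.
Qed.

Lemma below0 f : f \in below S wt 0 -> f = 0.
Proof. by move/belowP=> Sf; apply/malgP => w; rewrite mcoeff0; apply: (Sf w).2. Qed.

Lemma belowZ d c f : c \in S -> f \in below S wt d -> c *: f \in below S wt d.
Proof.
move=> Sc /belowP Sf; apply/belowP => w; have [Sfw f0] := Sf w.
by rewrite mcoeffZ rpredM //; split=> // /f0->; rewrite mulr0.
Qed.

Lemma belowU w : << w >> \in below S wt (wt w).+1.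
Proof.
apply/belowP => w'; rewrite mcoeffU1; case: eqP => [<-|_].
  by rewrite rpred1 ltnn.
by rewrite rpred0.
Qed.

(** Weights at most d - 1 and at most e - 1 add up to at most d + e - 2. *)
Lemma belowM (wtM : {morph wt : u v / mmul u v >-> (u + v)%N}) d e f g :
    f \in below S wt d -> g \in below S wt e ->
  f * g \in below S wt (d + e).-1.
Proof.
move=> /belowP Sf /belowP Sg; apply/belowP => w; rewrite mcoeffMl; split.
  apply: rpred_sum => u _; apply: rpred_sum => v _.
  by rewrite rpredMn // rpredM //; [case: (Sf u) | case: (Sg v)].
move=> ledew; rewrite big1 // => u _; rewrite big1 // => v _.
case: eqP => [def_w|_]; last exact: mulr0n.
have [ledu|ltud] := leqP d (wt u); first by rewrite (Sf u).2 // mul0r mul0rn.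
by rewrite (Sg v).2 ?mulr0 ?mul0rn //; move: ledew; rewrite -def_w wtM; lia.
Qed.

Lemma monalgOver_below f : f \in monalgOver S -> exists d, f \in below S wt d.
Proof.
move=> /allP Sf; exists (\max_(w <- msupp f) (wt w).+1)%N.
by apply/allP => w w_f; rewrite Sf //=; apply: leq_bigmax_seq.
Qed.

Variable v : M -> {malg R[M]}.
Hypothesis v_lead : forall w, v w - << w >> \in below S wt (wt w).

(** [mmap (@malgC M R) v] is the linear map that sends each word [w] to [v w].
    It is the identity plus a map that lowers the filtration, so that it is
    inverted step by step; this is the content of the lemmas below. *)
Lemma mmapCE g : mmap (@malgC M R) v g = \sum_(w <- msupp g) g@_w *: v w.
Proof. by rewrite mmapE; apply: eq_bigr => w _; rewrite mul_malgC. Qed.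

Lemma mmapC_sub_below d g :
  g \in below S wt d.+1 -> mmap (@malgC M R) v g - g \in below S wt d.
Proof.
move=> /allP Sg; rewrite mmapCE [X in _ - X]monalgE -sumrB big_seq.
apply: rpred_sum => w /Sg /andP[Sgw lewd].
have -> : << g@_w *g w >> = g@_w *: << w >> :> {malg R[M]}.
  by apply/malgP => u; rewrite mcoeffZ !mcoeffU mulr_natr.
by rewrite -scalerBr belowZ // (@below_leq (wt w)).
Qed.

Lemma mmapC_onto d f : f \in below S wt d ->
  exists2 g, g \in monalgOver S & f = mmap (@malgC M R) v g.
Proof.
elim: d f => [|d IHd] f Sf.
  by exists 0; [exact: monalgOver0 | rewrite (below0 Sf) raddf0].
have [g Sg defg] := IHd _ (mmapC_sub_below Sf); exists (f - g).
  rewrite rpredB //; apply/monalgOverP => w; exact: (belowP _ _ Sf w).1.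
by rewrite raddfB /= -defg opprB addrC subrK.
Qed.

Lemma mmapC_inj d g :
  g \in below S wt d -> mmap (@malgC M R) v g = 0 -> g = 0.
Proof.
elim: d => [|d IHd] Sg vg0; first exact: below0 Sg.
apply: IHd => //; have := mmapC_sub_below Sg.
by rewrite vg0 sub0r rpredN.
Qed.

(** The indexing by [h] serves families whose natural indices are not the
    monomials themselves. *)
Lemma unitriangular_basis (T : choiceType) (h : T -> M) :
    bijective h ->
  is_basis_over [set` S]%classic
    [set f : {malg R[M]} | forall w, f@_w \in [set` S]%classic]%classic
    (fun i => v (h i)).
Proof.
move=> [h' hK h'K]; have h_inj := can_inj hK.
split=> [i|f|A c Sc].
- rewrite inE /= => w; rewrite inE /= -[v _](subrK << h i >>) mcoeffD rpredD //.
    exact: (belowP _ _ (v_lead (h i)) w).1.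
  exact: (belowP _ _ (belowU (h i)) w).1.
- rewrite inE /= => Sf; have {Sf}/monalgOver_below[d Sf] : f \in monalgOver S.
    by apply/monalgOverP => w; have := Sf w; rewrite inE.
  have [g /monalgOverP Sg ->] := mmapC_onto Sf.
  exists [fset h' w | w in msupp g]%fset, (fun i => g@_(h i)).
  split=> [i|]; first by rewrite inE /=.
  rewrite mmapCE big_imfset /=; last by move=> u w _ _ /(can_inj h'K).
  by apply: eq_bigr => w _; rewrite h'K.
pose g : {malg R[M]} := \sum_(i <- A) << c i *g h i >>.
have gE i : i \in A -> g@_(h i) = c i.
  move=> iA; rewrite /g raddf_sum /= (big_fsetD1 i) //= mcoeffUU big_seq big1.
    by rewrite addr0.
  move=> j; rewrite in_fsetD1 => /andP[neq _].
  by rewrite mcoeffU (inj_eq h_inj) (negPf neq).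
move=> sum0 i iA; rewrite -gE //.
have [d Sg] : exists d, g \in below S wt d.
  apply: monalgOver_below; apply: rpred_sum => j _; rewrite monalgOverU.
  by have := Sc j; rewrite inE /= => ->; rewrite orbT.
suff -> : g = 0 by rewrite mcoeff0.
apply: (mmapC_inj Sg); rewrite /g raddf_sum /= -[RHS]sum0.
by apply: eq_bigr => j _; rewrite mmapU mul_malgC.
Qed.

End Below.

(** * Ribbon functions are unitriangular *)

(** [Za a] as a boolean predicate, to which the closure properties of a subring
    can be attached. *)
Definition Za_pred (k : fieldType) (a : int -> k) : {pred k} := [in Za a].

Section ZaTheory.
Variables (k : fieldType) (a : int -> k).

Lemma Za_subring_closed : GRing.subring_closed (Za_pred a).
Proof.
split=> [|x y|x y]; rewrite /Za_pred !inE.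
- by move=> A [[A1 _ _] _]; exact: set_mem A1.
- move=> Ax Ay A AP; have [[_ AB _] _] := AP.
  by apply/set_mem/AB; rewrite inE; [exact: Ax | exact: Ay].
move=> Ax Ay A AP; have [[_ _ AM] _] := AP.
by apply/set_mem/AM; rewrite inE; [exact: Ax | exact: Ay].
Qed.

HB.instance Definition _ :=
  GRing.isSubringClosed.Build k (Za_pred a) Za_subring_closed.

Lemma mem_Za i : a i \in Za_pred a.
Proof. by rewrite /Za_pred inE => A [_]; apply; exists i. Qed.

Lemma inv_factorial_Za (b : int -> k) (n N : nat) :
  (forall i, b i \in Za_pred a) -> inv_factorial b n N \in Za_pred a.
Proof.
move=> Zb; elim: n N => [|n IHn] N /=; first exact: rpred_nat.
apply: rpred_sum => j _; rewrite rpredM //.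
by case: (N - j)%N => [|l] /=; rewrite ?rpred0 ?rpredX.
Qed.

End ZaTheory.

(** The letter [j] stands for the part [j.+1], so that this is the sum of the
    parts plus their number.  The sum alone does not decrease when two parts are
    merged, and the number alone does not decrease under a shift. *)
Definition word_wt (w : {fmonom nat}) : nat := (sumn (map succn w) + size w)%N.

Lemma word_wtM : {morph word_wt : u v / mmul u v >-> (u + v)%N}.
Proof.
by move=> u v; rewrite /word_wt fmM map_cat sumn_cat size_cat addnACA.
Qed.

Definition word_of (I : seq nat) : {fmonom nat} := FMonom (map predn I).

Lemma word_of_cons (i : nat) (I : seq nat) :
  word_of (i :: I) = mmul (fmu i.-1) (word_of I).
Proof. by apply/val_inj; rewrite /= fmM fmU. Qed.

Lemma word_wt_of (I : seq nat) :
  is_composition I -> word_wt (word_of I) = (sumn I + size I)%N.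
Proof.
rewrite /word_wt /= size_map -map_comp => /allP I0; congr (sumn _ + _)%N.
by rewrite -[RHS]map_id; apply/eq_in_map => i /I0 /prednK.
Qed.

Lemma mul_sub_lead (R : nzRingType) (s r u s0 r0 : R) :
  s * r - u - s0 * r0 = (s - s0) * r + s0 * (r - r0) - u.
Proof. by rewrite mulrBl mulrBr addrA addrNK addrAC. Qed.

Section Leading.
Variables (k : fieldType) (a : int -> k).

Local Notation low := (@below k {fmonom nat} (Za_pred a) word_wt).

Lemma Sgen_low (n : nat) : Sgen k n \in low n.+2.
Proof.
case: n => [|n] /=.
  apply: (@below_leq _ _ _ _ (word_wt mone).+1); last exact: belowU.
  by rewrite /word_wt fm1.
apply: (@below_leq _ _ _ _ (word_wt (fmu n)).+1); last exact: belowU.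
by rewrite /word_wt fmU /= addn0 addn1.
Qed.

(** The coefficient of [t^(-n)] in the equation defining the shift is
    unitriangular with entries in Z[a] on both sides, so it expresses the
    difference by terms of index less than [n]. *)
Lemma Sshift_low (s : int) (n : nat) : Sshift a s n - Sgen k n \in low n.+1.
Proof.
elim/ltn_ind: n => n IHn.
have := congr1 (fun f => f n) (SshiftP a s).
rewrite /factorial_series !big_ord_recr /= !inv_factorial_diag !scale1r => eqS.
have -> : Sshift a s n - Sgen k n
    = \sum_(j < n) inv_factorial a j n *: Sgen k j
      - \sum_(j < n) inv_factorial (tau (- s) a) j n *: Sshift a s j.
  by rewrite (canRL (addKr _) eqS) addrA addrK addrC.
rewrite rpredB //; apply: rpred_sum => j _; apply: belowZ.
- by apply: inv_factorial_Za; exact: mem_Za.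
- by apply: (@below_leq _ _ _ _ j.+2); [rewrite ltnS | exact: Sgen_low].
- by apply: inv_factorial_Za => i; exact: mem_Za.
apply: (@below_leq _ _ _ _ j.+2); first by rewrite ltnS.
rewrite -[Sshift _ _ _](subrK (Sgen k j)).
rewrite rpredD ?Sgen_low //; apply: (@below_leq _ _ _ _ j.+1) => //.
exact: IHn.
Qed.

(** Induction with the rule [ribbonK_cons2]: in the product, replacing either
    factor by its leading word costs lower terms, and the function of the merged
    composition has weight one less because one part has disappeared. *)
Lemma ribbonK_low (I : seq nat) (K : nat -> int) : is_composition I ->
  ribbonK a I K - << word_of I >> \in low (sumn I + size I).
Proof.
have [n leIn] := ubnP (size I); elim: n => // n IHn in I K leIn *.
case: I leIn => [|i [|j I]] leIn.
- have -> : word_of [::] = mone by apply/val_inj; rewrite /= fm1.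
  by rewrite /= subrr rpred0.
- rewrite ribbonK1 /= andbT => i0; rewrite addn0 addn1.
  have -> : << word_of [:: i] >> = Sgen k i; last exact: Sshift_low.
  by case: i i0 {leIn} => // i _ /=; rewrite /word_of fmuE.
move=> I0; have [i0 jI0] := andP I0; have [j0 I0'] := andP jI0.
rewrite ribbonK_cons2 word_of_cons.
set s := Sshift a _ i; set r := ribbonK a (j :: I) _.
set r' := ribbonK a ((i + j)%N :: I) _; set w := word_of (j :: I).
have -> : << mmul (fmu i.-1) w >> = Sgen k i * << w >>.
  by case: (i) i0 => // i' _ /=; rewrite malgM_def fgmulUU mulr1.
rewrite (mul_sub_lead s r r').
have r_low : r - << w >> \in low (sumn (j :: I) + size (j :: I)) by exact: IHn.
have r_low1 : r \in low (sumn (j :: I) + size (j :: I)).+1.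
  rewrite -[r](subrK << w >>) rpredD //; first exact: below_leq r_low.
  by rewrite -word_wt_of //; exact: belowU.
have s_low : s - Sgen k i \in low i.+1 by exact: Sshift_low.
have i_low : Sgen k i \in low i.+2 by exact: Sgen_low.
have r'_low : r' \in low (sumn ((i + j)%N :: I) + size ((i + j)%N :: I)).+1.
  have ijI0 : is_composition ((i + j)%N :: I) by rewrite /= addn_gt0 i0.
  rewrite -[r'](subrK << word_of ((i + j)%N :: I) >>) rpredD //.
    by apply: (@below_leq _ _ _ _ _ _ (leqnSn _)); exact: IHn.
  by rewrite -word_wt_of //; exact: belowU.
rewrite rpredB ?rpredD //.
- apply: below_leq (belowM word_wtM s_low r_low1) => /=; lia.
- apply: below_leq (belowM word_wtM i_low r_low) => /=; lia.
by apply: below_leq r'_low => /=; lia.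
Qed.

End Leading.

Theorem theorem26 (k : fieldType) (char0 : [pchar k] =i pred0) (a : int -> k) :
  is_basis_over (Za a) (SymZ a) (fun I : composition => ribbon a (val I))
  /\ (forall I J : seq nat,
        is_composition I -> is_composition J -> I != [::] -> J != [::] ->
        ((2 <= size J)%N ->
           ribbon_sh a ((sumn J)%:Z - (last 0%N J)%:Z + (last 0%N I)%:Z) I
             * ribbon a J
           = ribbon a (I ++ J) + ribbon a (near_concat I J))
        /\ (forall j : nat, J = [:: j] ->
           ribbon_sh a (last 0%N I)%:Z I * Sgen k j
           = ribbon a (I ++ [:: j])
             + ribbon_sh a (last 0%N I)%:Z (near_concat I [:: j]))).
Proof.
split=> [|I J _ _ I0 _]; last first.
  split=> [J2|j _]; [exact: ribbon_mul_ge2 | exact: ribbon_mul_Sgen].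
pose v (w : {fmonom nat}) := ribbon a (map succn w).
have comp_of (w : {fmonom nat}) : is_composition (map succn w).
  by apply/allP => _ /mapP[j _ ->].
pose h (I : composition) := word_of (val I).
have hK (I : composition) : map succn (h I) = val I.
  rewrite /h /= -map_comp -[RHS]map_id; apply/eq_in_map => i.
  by move/(allP (valP I))/prednK.
have h_bij : bijective h.
  exists (fun w : {fmonom nat} => Sub (map succn w) (comp_of w)) => [I|w];
    apply/val_inj.
    by rewrite SubK hK.
  by rewrite /h /= mapK.
have v_low w : v w - << w >> \in below (Za_pred a) word_wt (word_wt w).
  have := ribbonK_low a (ribbon_shift (map succn w)) (comp_of w).
  have -> : word_of (map succn w) = w by apply/val_inj; rewrite /= mapK.
  by rewrite size_map.
have := unitriangular_basis v_low h_bij.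
rewrite (_ : [set` Za_pred a]%classic = Za a); last exact: set_mem_set.
rewrite (_ : (fun i => v (h i)) = fun I => ribbon a (val I)); last first.
  by apply/funext => I; rewrite /v hK.
by [].
Qed.
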